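(* Let $\mathcal A$ be a real algebra. If $\mathcal A$ is partially left alternative or partially right alternative, then $\mathcal A$ is an even-dimensional real vector space.
   Context: Algebras are real vector spaces with a bilinear product, not necessarily associative. For a real algebra $\mathcal A$ with unit element $1$, an imaginary unit is an element $q\in\mathcal A$ with $q^2=-1$, and $\mathcal I_{\mathcal A}$ denotes the set of all imaginary units in $\mathcal A$. Put $(a,b,c)=(ab)c-a(bc)$ for $a,b,c\in\mathcal A$. A real algebra $\mathcal A$ with a unit element $1$ and $\mathcal I_{\mathcal A}\neq\emptyset$ is called partially left alternative if $(x,x,y)=0$ for all $x\in\mathcal I_{\mathcal A}$ and $y\in\mathcal A$, and partially right alternative if $(y,x,x)=0$ for all $x\in\mathcal I_{\mathcal A}$ and $y\in\mathcal A$. The existence of a unit and the nonemptiness of $\mathcal I_{\mathcal A}$ are part of the definition in both cases. *)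

(* Defs.v *)
From mathcomp Require Import all_boot all_order all_algebra.
From mathcomp Require Import sesquilinear reals.

Set Implicit Arguments.
Unset Strict Implicit.
Unset Printing Implicit Defensive.

Import GRing.Theory.
Local Open Scope ring_scope.

(* A real algebra, not necessarily associative, unital or finite-dimensional,
   is a vector space [A : lmodType R] over the reals [R : realType] with a
   bilinear product [mul : {bilinear A -> A -> A}]. *)

Section Algebra.
Variables (R : realType) (A : lmodType R) (mul : {bilinear A -> A -> A}).

Definition is_unit_element (e : A) : Prop :=
  forall x : A, mul e x = x /\ mul x e = x.

Definition imaginary_unit (e q : A) : Prop := mul q q = - e.

Definition associator (a b c : A) : A := mul (mul a b) c - mul a (mul b c).

(* The unit element [e] is unique when it exists. *)
Definition partially_left_alternative : Prop :=
  exists e : A,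
    [/\ is_unit_element e,
        exists q : A, imaginary_unit e q
      & forall x y : A, imaginary_unit e x -> associator x x y = 0].

Definition partially_right_alternative : Prop :=
  exists e : A,
    [/\ is_unit_element e,
        exists q : A, imaginary_unit e q
      & forall x y : A, imaginary_unit e x -> associator y x x = 0].

End Algebra.

Section Dimension.
Variables (R : realType) (V : lmodType R).

(* Algebraic (Hamel) bases: only finite linear combinations occur, and the
   index type [I] may be infinite. *)
Definition linearly_independent (I : Type) (b : I -> V) : Prop :=
  forall (n : nat) (f : 'I_n -> I) (c : 'I_n -> R), injective f ->
    \sum_(k < n) c k *: b (f k) = 0 -> forall k : 'I_n, c k = 0.

Definition spanning (I : Type) (b : I -> V) : Prop :=
  forall v : V, exists (n : nat) (f : 'I_n -> I) (c : 'I_n -> R),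
    v = \sum_(k < n) c k *: b (f k).

(* The dimension of [V] is the cardinality of [I]. *)
Definition has_dimension (I : Type) : Prop :=
  exists b : I -> V, linearly_independent b /\ spanning b.

(* The dimension is twice a cardinal: [I + I] is the disjoint sum of two copies
   of [I]. If [V] has finite dimension [n], then [I] is finite and
   [n = 2 * #|I|], so that [n] is an even natural number. *)
Definition even_dimensional : Prop := exists I : Type, has_dimension (I + I).

End Dimension.

(* Main.v *)
(** Fix an imaginary unit [q]. Partial left (right) alternativity makes the
    left (right) multiplication [J] by [q] satisfy [J^2 = -1], so [J] turns the
    algebra into a complex vector space. If [S] is a complex Hamel basis, the
    disjoint union of [S] and [J S] is a real Hamel basis. *)

Require Import Defs.
From mathcomp Require Import all_boot all_order all_algebra.
From mathcomp Require Import sesquilinear reals.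
From mathcomp Require Import boolp classical_sets ring.

Set Implicit Arguments.
Unset Strict Implicit.
Unset Printing Implicit Defensive.

Import GRing.Theory Num.Theory.
Local Open Scope ring_scope.
Local Open Scope classical_set_scope.

Section ComplexStructure.
Variables (R : realType) (V : lmodType R) (J : {linear V -> V}).
Hypothesis JJ : forall v, J (J v) = - v.

(* [(a + b i) v] for the complex structure given by [J]. *)
Definition cscale (a b : R) (v : V) : V := a *: v + b *: J v.

Lemma cscale0 v : cscale 0 0 v = 0.
Proof. by rewrite /cscale !scale0r addr0. Qed.

Lemma cscale_sum a b I (s : seq I) (F : I -> V) :
  cscale a b (\sum_(i <- s) F i) = \sum_(i <- s) cscale a b (F i).
Proof. by rewrite /cscale (raddf_sum J) !scaler_sumr big_split. Qed.

(** By [JJ], the term in [b * d] changes sign, so the pairs of coefficients multiply as complex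
    numbers. *)
Lemma cscaleA a b c d v :
  cscale a b (cscale c d v) = cscale (a * c - b * d) (a * d + b * c) v.
Proof.
rewrite /cscale (linearD J) !(linearZ_LR J) /= JJ !scalerDr !scalerN !scalerA.
by rewrite [X in _ + X]addrC addrACA scalerBl scalerDl.
Qed.

(** Each entry carries its own coefficients, so vectors may repeat and no terms ever have to be
    merged. *)
Definition cspan (S : set V) (v : V) : Prop :=
  exists s : seq (V * (R * R)), {in s, forall t, S t.1} /\
    v = \sum_(t <- s) cscale t.2.1 t.2.2 t.1.

Lemma cspan_cscale S a b v : cspan S v -> cspan S (cscale a b v).
Proof.
case=> s [sS ->].
exists [seq (t.1, (a * t.2.1 - b * t.2.2, a * t.2.2 + b * t.2.1)) | t <- s].
split=> [_ /mapP[t ts ->]|]; first exact: (sS t ts).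
by rewrite cscale_sum big_map; apply: eq_bigr => t _; rewrite cscaleA.
Qed.

Definition cindependent (S : set V) : Prop :=
  forall (s : seq V) (a b : V -> R), uniq s -> {in s, forall x, S x} ->
    \sum_(x <- s) cscale (a x) (b x) x = 0 ->
  {in s, forall x, a x = 0 /\ b x = 0}.

(** In a relation involving [v], a nonzero complex coefficient of [v] could be inverted, which would
    put [v] in the span of [S]. *)
Lemma cindependentU1 S v :
  cindependent S -> ~ cspan S v -> cindependent (S `|` [set v]).
Proof.
move=> indS vS s a b us sSv.
have remS : {in rem v s, forall x, S x}.
  move=> x; rewrite mem_rem_uniq // inE => /andP[/eqP xv /sSv].
  by case.
have [vs|vs] := boolP (v \in s); last first.
  by move=> s0; apply: indS s0 => //; rewrite -(rem_id vs).
rewrite (perm_big _ (perm_to_rem vs)) big_cons /= => s0.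
have [av bv] : a v = 0 /\ b v = 0.
  apply: contrapT => ab; apply: vS.
  have: cspan S (cscale (a v) (b v) v).
    exists [seq (x, (- a x, - b x)) | x <- rem v s]; split.
      by move=> _ /mapP[x xs ->]; exact: remS.
    move/eqP: s0; rewrite addr_eq0 => /eqP ->; rewrite big_map -sumrN.
    by apply: eq_bigr => x _; rewrite /cscale /= !scaleNr opprD.
  (* [(a v - b v i) / d] is the inverse of [a v + b v i]. *)
  pose d := a v ^+ 2 + b v ^+ 2.
  have d0 : d != 0.
    apply/eqP => /eqP; rewrite paddr_eq0 ?sqr_ge0 // !sqrf_eq0.
    by move=> /andP[/eqP ? /eqP ?]; apply: ab.
  move=> /(@cspan_cscale _ (d^-1 * a v) (d^-1 * - b v)); rewrite cscaleA.
  rewrite (_ : _ - _ = d^-1 * d); last by rewrite /d; ring.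
  rewrite (_ : _ + _ = 0); last by ring.
  by rewrite mulVf // /cscale scale1r scale0r addr0.
move: s0; rewrite av bv cscale0 add0r => s0 x xs.
have [->//|xv] := eqVneq x v.
apply: (indS _ _ _ _ remS s0); first exact: rem_uniq.
by rewrite mem_rem_uniq // inE xv.
Qed.

(** A relation involves finitely many vectors, and in a chain these all lie in a single member. *)
Lemma cindependent_bigcup (F : set (set V)) :
  F `<=` cindependent -> total_on F subset ->
  cindependent (\bigcup_(X in F) X).
Proof.
move=> indF totF s a b us sF.
(* The empty list is set apart because the chain [F] may be empty. *)
suff [->//|[X FX sX]] : s = [::] \/ exists2 X, F X & {in s, forall x, X x}.
  exact: indF FX _ _ _ us sX.
elim: s sF {us} => [|x s IHs] sF; [by left | right].
have [Y FY Yx] := sF x (mem_head x s).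
have [|->|[X FX sX]] := IHs.
- by move=> y ys; apply: sF; rewrite inE ys orbT.
- by exists Y => // y; rewrite inE => /eqP->.
have [XY|YX] := totF _ _ FX FY; [exists Y|exists X] => // y;
  rewrite inE => /orP[/eqP->|/sX] //; [exact: XY | exact: YX].
Qed.

Lemma cbasis_exists : exists S : set V, cindependent S /\ forall v, cspan S v.
Proof.
have [S [indS maxS]] := Zorn_bigcup cindependent_bigcup.
exists S; split=> // v; apply: contrapT => vS.
apply: (maxS (S `|` [set v])); last exact: cindependentU1.
split=> [|SU]; first exact: subsetUl.
apply: vS; exists [:: (v, (1, 0))]; split.
  by move=> t; rewrite inE => /eqP->; apply: SU; right.
by rewrite big_seq1 /cscale scale1r scale0r addr0.
Qed.

Definition double (S : set V) (i : S + S) : V :=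
  match i with inl x => val x | inr x => J (val x) end.

(** Grouping a real relation by underlying vectors [x] of [S] gives a complex one: the [inl] terms
    contribute the real part [a x], the [inr] terms the imaginary part [b x]. *)
Lemma double_independent S :
  cindependent S -> linearly_independent (@double S).
Proof.
move=> indS n f c injf f0.
pose p k : V := match f k with inl x | inr x => val x end.
pose l k := if f k is inl _ then true else false.
pose a x := \sum_(k < n | (p k == x) && l k) c k.
pose b x := \sum_(k < n | (p k == x) && ~~ l k) c k.
pose s := undup [seq p k | k <- enum 'I_n].
have ps k : p k \in s by rewrite mem_undup map_f // mem_enum.
have sS : {in s, forall x, S x}.
  move=> x; rewrite mem_undup => /mapP[k _ ->].
  by rewrite /p; case: (f k) => y; exact: set_mem (valP y).
have s0 : \sum_(x <- s) cscale (a x) (b x) x = 0.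
  rewrite -[RHS]f0.
  transitivity
      (\sum_(x <- s) \sum_(k < n | p k == x) c k *: double (f k)).
    apply: eq_bigr => x _; rewrite (bigID l) /cscale !scaler_suml.
    congr (_ + _); apply: eq_bigr => k /andP[/eqP <-];
      by rewrite /l /p; case: (f k).
  (* As [s] has no duplicates, each index [k] is counted exactly once, at [x = p k]. *)
  rewrite (exchange_big_dep xpredT) //=; apply: eq_bigr => k _.
  rewrite (eq_bigl (pred1 (p k))) => [|x]; last by rewrite /= eq_sym.
  by rewrite -big_filter filter_pred1_uniq ?undup_uniq // big_seq1.
move=> k; have [ak bk] := indS _ _ _ (undup_uniq _) sS s0 _ (ps k).
(* Since [f] is injective, the vector and the side determine the index, so the sum defining
   [a (p k)] or [b (p k)] on the side of [k] reduces to [c k]. *)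
have uniqk j : (p j == p k) && (l j == l k) = (j == k).
  apply/andP/eqP => [[/eqP pjk /eqP ljk]|->//].
  apply: injf; move: pjk ljk; rewrite /p /l.
  by case: (f j) (f k) => x [] y // /val_inj ->.
case lk: (l k); [rewrite -[RHS]ak /a | rewrite -[RHS]bk /b];
  rewrite (big_pred1 k) // => j; rewrite /= -uniqk lk ?eqb_id //.
by case: (l j).
Qed.

Lemma double_spanning S : (forall v, cspan S v) -> spanning (@double S).
Proof.
move=> spanS v; have [s [sS ->]] := spanS v.
(* Each complex term splits into two real ones; [r] may repeat indices, as [spanning] does not ask
   for an injective [f]. *)
suff [r ->] : exists r : seq ((S + S) * R),
    \sum_(t <- s) cscale t.2.1 t.2.2 t.1 = \sum_(t <- r) t.2 *: double t.1.
  exists (size r), (fun k => (tnth (in_tuple r) k).1).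
  by exists (fun k => (tnth (in_tuple r) k).2); rewrite big_tnth.
elim: s sS => [|[x [a b]] s IHs] sS; first by exists [::]; rewrite !big_nil.
have [|r rE] := IHs.
  by move=> t ts; apply: sS; rewrite inE ts orbT.
have Sx : x \in S by apply/mem_set/(sS (x, (a, b)))/mem_head.
exists [:: (inl (Sub x Sx), a), (inr (Sub x Sx), b) & r].
by rewrite !big_cons rE addrA.
Qed.

Lemma complex_structure_even_dimensional : even_dimensional V.
Proof.
have [S [indS spanS]] := cbasis_exists.
exists S, (@double S); split; first exact: double_independent.
exact: double_spanning.
Qed.

End ComplexStructure.

Theorem corollary1 (R : realType) (A : lmodType R)
    (mul : {bilinear A -> A -> A}) :
  partially_left_alternative mul \/ partially_right_alternative mul ->
  even_dimensional A.
Proof.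
case=> -[e [unit_e [q qq] alt]].
  apply: (@complex_structure_even_dimensional _ _ (mul q)) => v.
  (* The vanishing associator gives [q (q v) = (q q) v = - v]. *)
  rewrite -[LHS](subr0_eq (alt q v qq)).
  by rewrite qq linearNl (unit_e v).1.
apply: (@complex_structure_even_dimensional _ _ (applyr mul q)) => v.
rewrite [LHS](subr0_eq (alt q v qq)).
by rewrite qq linearNr (unit_e v).2.
Qed.
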